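(* Let $n \geq 2$ be an integer, let $\mathsf{Alist}_n = \langle 1,y_1\rangle \to \langle 2,y_2\rangle \to \cdots \to \langle \mathsf{sr}(n),y_{\mathsf{sr}(n)}\rangle$ with $y_1 = n$, and let $\mathsf{Tchouk}_{n-1} = (b_1,\ldots,b_\ell)$. Then: (a) $\ell = \mathsf{sr}(n)-1$; (b) for $i = 1,2,\ldots,\mathsf{sr}(n)-1$, $b_i = 2i+1+iy_i-(i+1)y_{i+1}$; (c) for $i=1,2,\ldots,\mathsf{sr}(n)$, $y_i = i + \frac{1}{i}\,(b_i + b_{i+1} + \cdots + b_{\mathsf{sr}(n)-1})$ (an empty sum being $0$).
   Context: For $n \in \{1,2,\ldots\}$, $\mathsf{Alist}_n$ is the sequence of integer pairs produced as follows: begin with $\langle 1, n\rangle$, i.e. $y_1=n$. Given the current pair $\langle i, y_i\rangle$ with $y_i > i$, the next pair is $\langle i+1, y_{i+1}\rangle$, where $y_{i+1}$ is the smallest integer with $(i+1)y_{i+1} > i(y_i+1)$. Stop when the current pair $\langle i,y_i\rangle$ satisfies $y_i \leq i$. This process always terminates; its final pair is denoted $\langle \mathsf{sr}(n), y_{\mathsf{sr}(n)}\rangle$, and $\mathsf{sr}(n)$ is called the strange root of $n$. Tchoukaillon solitaire: a board consists of a pit (hole $0$) followed by holes $1,2,3,\ldots$; a configuration $c=(c_1,c_2,\ldots)$ records the number $c_i$ of stones in hole $i$ (the pit is not recorded). A move selects a hole $i$ containing $s_i$ stones, removes them, and puts one stone in each of holes $i-1,i-2,\ldots,i-s_i$ (the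 move is illegal, and the game lost, if $s_i > i$). The game is won if all stones reach the pit. For each $n\ge 0$ there is a unique winning configuration with $n$ stones, denoted $\mathsf{Tchouk}_n$; explicitly $\mathsf{Tchouk}_0 = ()$ and for $n\geq 1$, $\mathsf{Tchouk}_n = (c_1,\ldots,c_\ell)$ where $c_1 = n \bmod 2$ and $c_k = \bigl(n-(c_1+\cdots+c_{k-1})\bigr) \bmod (k+1)$, stopping at the first $\ell$ with $c_1+\cdots+c_\ell = n$ (so $c_\ell \neq 0$, i.e. $\ell$ is the index of the last nonempty hole). For example $\mathsf{Tchouk}_{10} = (0,1,1,3,5)$. *)

(* Defs.v *)
From mathcomp Require Import all_boot all_order all_algebra.
From mathcomp Require Import zify.

Set Implicit Arguments.
Unset Strict Implicit.
Unset Printing Implicit Defensive.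

Lemma Anext_ex (i y : nat) : exists z : nat, i * y.+1 < i.+1 * z.
Proof. by exists y.+2; nia. Qed.

(* The smallest integer z with (i+1) z > i (y+1). The bound is nonnegative,
   so such a z is positive and the minimum over nat is the minimum over the
   integers. *)
Definition Anext (i y : nat) : nat := ex_minn (Anext_ex i y).

Definition Astep (p : nat * nat) : nat * nat := (p.1.+1, Anext p.1 p.2).

Lemma Anext_le (i y : nat) : i < y -> Anext i y <= y.
Proof.
by rewrite /Anext; case: ex_minnP => z _ zmin ltiy; apply: zmin; nia.
Qed.

Lemma Astep_iter1 (n k : nat) : (iter k Astep (1, n)).1 = k.+1.
Proof. by elim: k => //= k ->. Qed.

Lemma Astop_ex (n : nat) :
  exists k, (iter k Astep (1, n)).2 <= (iter k Astep (1, n)).1.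
Proof.
have H k : (exists j, (iter j Astep (1, n)).2 <= (iter j Astep (1, n)).1)
           \/ (iter k Astep (1, n)).2 <= n.
  elim: k => [|k [IH|IH]]; [by right | by left |].
  case: (leqP (iter k Astep (1, n)).2 (iter k Astep (1, n)).1) => Hk.
    by left; exists k.
  by right; rewrite iterS /=; apply: leq_trans (Anext_le Hk) IH.
by case: (H n) => // Hn; exists n; rewrite Astep_iter1; lia.
Qed.

(* Number of steps before the first pair <i, y> with y <= i. *)
Definition Astop (n : nat) : nat := ex_minn (Astop_ex n).

Definition Alist (n : nat) : seq (nat * nat) :=
  traject Astep (1, n) (Astop n).+1.

(* The strange root: first component of the final pair. *)
Definition sr (n : nat) : nat := (last (1, n) (Alist n)).1.

(* y_i, indexed from 1; meaningful for 1 <= i <= sr n. *)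
Definition Ay (n i : nat) : nat := (nth (0, 0) (Alist n) i.-1).2.

(* (c_1, ..., c_k) with c_j = (n - (c_1 + ... + c_{j-1})) mod (j + 1). *)
Fixpoint Tchouk_prefix (n k : nat) : seq nat :=
  if k is k'.+1 then
    let c := Tchouk_prefix n k' in rcons c ((n - sumn c) %% k.+1)
  else [::].

Lemma Tchouk_stop_ex (n : nat) : exists l, sumn (Tchouk_prefix n l) == n.
Proof.
case: n => [|n]; first by exists 0.
exists n.+1 => /=; rewrite sumn_rcons.
have H k : sumn (Tchouk_prefix n.+1 k) <= n.+1.
  elim: k => //= k IH; rewrite sumn_rcons.
  by have := leq_mod (n.+1 - sumn (Tchouk_prefix n.+1 k)) k.+2; lia.
by rewrite modn_small; have := H n; lia.
Qed.

(* The explicit winning configuration, cut at the first l with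
   c_1 + ... + c_l = n. It is the unique one when each move must drop its
   last stone in the pit; if shorter sowings were allowed, (1) and (0, 1)
   would both win with one stone. *)
Definition Tchouk (n : nat) : seq nat :=
  Tchouk_prefix n (ex_minn (Tchouk_stop_ex n)).

(* Contents of hole i of Tchouk_n; holes are numbered from 1. *)
Definition hole (n i : nat) : nat := nth 0 (Tchouk n) i.-1.

(* Main.v *)
Require Import Defs.
From mathcomp Require Import all_boot all_order all_algebra.
From mathcomp Require Import zify ring.

Set Implicit Arguments.
Unset Strict Implicit.
Unset Printing Implicit Defensive.

Import Order.TTheory GRing.Theory Num.Theory.

(** Let [r_k] be the number of stones of [Tchouk_(n-1)] lying beyond hole [k].
The invariant [i * y_i = i ^ 2 + r_(i-1)] is preserved by both processes:
[y_(i+1) = i + 1 + r_(i-1) %/ (i+1)], so that passing from [i] to [i+1] removes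
[r_(i-1) %% (i+1) = b_i] from [r_(i-1)].  In particular [y_i <= i] exactly when
[r_(i-1) = 0], so both processes stop together; (b) is the difference of two
consecutive invariants, and (c) is the invariant divided by [i]. *)

(** The board here carries [n] stones, so lemmas that compare it with [Alist] take the latter at
    [n.+1]. *)
Definition Tchouk_left (n k : nat) : nat := n - sumn (Tchouk_prefix n k).

Definition Tchouk_len (n : nat) : nat := ex_minn (Tchouk_stop_ex n).

Lemma size_Tchouk_prefix n k : size (Tchouk_prefix n k) = k.
Proof. by elim: k => //= k IH; rewrite size_rcons IH. Qed.

Lemma sumn_Tchouk_prefix_le n k : sumn (Tchouk_prefix n k) <= n.
Proof.
elim: k => //= k IH; rewrite sumn_rcons.
by have := leq_mod (n - sumn (Tchouk_prefix n k)) k.+2; lia.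
Qed.

(** Longer prefixes extend shorter ones by [rcons], so the entry is fixed once written; position [k]
    is hole [k.+1], hence the modulus [k.+2]. *)
Lemma nth_Tchouk_prefix n m k : k < m ->
  nth 0 (Tchouk_prefix n m) k = Tchouk_left n k %% k.+2.
Proof.
elim: m => // m IH; rewrite ltnS leq_eqVlt => /orP[/eqP <-|ltkm] /=.
  by rewrite nth_rcons size_Tchouk_prefix ltnn eqxx.
by rewrite nth_rcons size_Tchouk_prefix ltkm IH.
Qed.

Lemma Tchouk_leftS n k :
  Tchouk_left n k.+1 = Tchouk_left n k - Tchouk_left n k %% k.+2.
Proof. by rewrite /Tchouk_left /= sumn_rcons subnDA. Qed.

Lemma Tchouk_left_eq0 n k :
  (Tchouk_left n k == 0) = (sumn (Tchouk_prefix n k) == n).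
Proof. by rewrite /Tchouk_left subn_eq0 eqn_leq sumn_Tchouk_prefix_le. Qed.

Lemma Tchouk_left_len n : Tchouk_left n (Tchouk_len n) = 0.
Proof.
apply/eqP; rewrite Tchouk_left_eq0 /Tchouk_len.
by case: ex_minnP.
Qed.

Lemma hole_left n k : k < Tchouk_len n ->
  Tchouk_left n k = hole n k.+1 + Tchouk_left n k.+1.
Proof.
move=> ltk; rewrite /hole /Tchouk nth_Tchouk_prefix // Tchouk_leftS.
by rewrite subnKC // leq_mod.
Qed.

Lemma sum_hole n k : k <= Tchouk_len n ->
  \sum_(k.+1 <= j < (Tchouk_len n).+1) hole n j = Tchouk_left n k.
Proof.
(* Induction on the distance [d] to the last hole, as the sum is peeled from its lower end. *)
move: {2}(Tchouk_len n - k) (erefl (Tchouk_len n - k)) => d.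
elim: d k => [|d IH] k dE lek.
  have -> : k = Tchouk_len n by lia.
  by rewrite big_geq // Tchouk_left_len.
rewrite big_ltn; last by lia.
rewrite IH; [|lia|lia].
by rewrite -hole_left //; lia.
Qed.

(** With [r = q * i.+1 + s] and [s < i.+1], the bound [i * y.+1] equals [i.+1 * (i + q) + s], so the
    least multiplier exceeding it is [i + q + 1]. *)
Lemma Anext_of_invariant i y r : i * y = i ^ 2 + r ->
  Anext i y = (i + r %/ i.+1).+1.
Proof.
move=> inv; have := divn_eq r i.+1; have := ltn_pmod r (ltn0Sn i).
rewrite /Anext; case: ex_minnP; move: (r %/ i.+1) (r %% i.+1) => q s.
move=> z zgt zmin lts rE.
have := zmin (i + q).+1; move: inv zgt; rewrite !mulnS expnS expn1.
move=> inv zgt zle; apply/eqP; rewrite eqn_leq; apply/andP; split.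
  by apply: zle; nia.
by nia.
Qed.

Lemma Astep_invariant n k :
  k.+1 * (iter k Astep (1, n.+1)).2 = k.+1 ^ 2 + Tchouk_left n k.
Proof.
elim: k => [|k IH]; first by rewrite /Tchouk_left /=; lia.
rewrite iterS /Astep /= Astep_iter1 (Anext_of_invariant IH) Tchouk_leftS.
have := divn_eq (Tchouk_left n k) k.+2.
move: (_ %/ _) (_ %% _) => q s ->; rewrite !expnS expn0; nia.
Qed.

Lemma Astop_Tchouk_len n : Astop n.+1 = Tchouk_len n.
Proof.
rewrite /Astop /Tchouk_len; apply: eq_ex_minn => k.
(* Both stopping times are minima, so it suffices to match their predicates at each [k]; scaling by
   [k.+1] exposes the invariant. *)
rewrite -Tchouk_left_eq0 Astep_iter1 -(leq_pmul2l (ltn0Sn k)).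
rewrite Astep_invariant; lia.
Qed.

Lemma sr_Tchouk_len n : sr n.+1 = (Tchouk_len n).+1.
Proof.
by rewrite /sr /Alist trajectS /= last_traject Astep_iter1 Astop_Tchouk_len.
Qed.

Lemma Ay_invariant n k : k <= Tchouk_len n ->
  k.+1 * Ay n.+1 k.+1 = k.+1 ^ 2 + Tchouk_left n k.
Proof.
rewrite -Astop_Tchouk_len => lek.
(* The index is in range, so the default may become the starting pair, as [nth_traject] expects. *)
rewrite /Ay /Alist (set_nth_default (1, n.+1)) ?size_traject //.
by rewrite nth_traject // Astep_invariant.
Qed.

Local Open Scope ring_scope.

Theorem theorem3p3 (n : nat) (hn : (2 <= n)%N) :
  let y := Ay n in
  let b := hole (n - 1) in
  [/\ size (Tchouk (n - 1)) = (sr n - 1)%N,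
      (forall i : nat, (1 <= i <= sr n - 1)%N ->
         (b i)%:Z = 2 * i%:Z + 1 + i%:Z * (y i)%:Z
                    - (i%:Z + 1) * (y i.+1)%:Z) &
      (forall i : nat, (1 <= i <= sr n)%N ->
         (y i)%:R = i%:R + 1 / i%:R * \sum_(i <= j < sr n) (b j)%:R :> rat)].
Proof.
case: n hn => // n _; rewrite subn1 sr_Tchouk_len subn1 /=; split.
- exact: size_Tchouk_prefix.
- case=> // k /= ltk.
  have := Ay_invariant (ltnW ltk); have := Ay_invariant ltk.
  have := hole_left ltk; rewrite !expnS expn0; nia.
- case=> // k /= lek; rewrite -natr_sum sum_hole //.
  have nz : k.+1%:R != 0 :> rat by rewrite pnatr_eq0.
  apply: (mulfI nz); rewrite -natrM Ay_invariant // natrD natrX.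
  by field; rewrite addrC natr1.
Qed.
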